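(* Let $\rho_{AB}$ be a two-qubit state whose marginal $\rho_A=\operatorname{Tr}_B\rho_{AB}$ is maximally mixed, $\rho_A=\mathbb I/2$. Let $R_{\mu\nu}=\operatorname{Tr}[(\sigma_\mu\otimes\sigma_\nu)\rho_{AB}]$ for $\mu,\nu\in\{0,1,2,3\}$, let $\hat{\mathbf R}=[R_{ij}]_{i,j\in\{1,2,3\}}$, and let $s_1\ge s_2\ge s_3\ge0$ be the singular values (including zeros) of $\hat{\mathbf R}$. Then $Q^A_{\mathcal N}(\rho_{AB})=s_2/2$.
   Context: $\sigma_0=\mathbb I,\sigma_1=\sigma_x,\sigma_2=\sigma_y,\sigma_3=\sigma_z$. The negativity of a bipartite state $\tau_{X:Y}$ is $\mathcal N_{X:Y}(\tau)=(\|\tau^\Gamma\|_1-1)/2$ with $\tau^\Gamma$ the partial transpose on one party and $\|\cdot\|_1$ the trace norm. For $A$ of dimension $m$ and an orthonormal basis $\{|a_k\rangle\}$ of $A$, the measurement interaction is the isometry $V:A\to A\otimes A'$ ($A'$ $m$-dimensional with computational basis $\{|k\rangle\}$), $V|a_k\rangle=|a_k\rangle|k\rangle$. The one-sided negativity of quantumness is $Q^A_{\mathcal N}(\rho_{AB})=\min\mathcal N_{AB:A'}\big((V\otimes\mathbb I_B)\rho_{AB}(V\otimes\mathbb I_B)^\dagger\big)$ over all orthonormal bases of $A$. *)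

(* Defs.v *)
From HB Require Import structures.
From mathcomp Require Import all_boot all_order all_algebra.
From mathcomp Require Import mxtens.
Set Implicit Arguments.
Unset Strict Implicit.
Unset Printing Implicit Defensive.
Import Order.TTheory GRing.Theory Num.Theory Num.Def.
Local Open Scope ring_scope.

Section Q.
Variable C : numClosedFieldType.

Definition adj {m n} (M : 'M[C]_(m, n)) : 'M[C]_(n, m) := (map_mx conjC M)^T.

Definition pauli (mu : 'I_4) : 'M[C]_2 :=
  \matrix_(i < 2, j < 2)
    match val mu, val i, val j with
    | 0%N, 0%N, 0%N => 1 | 0%N, 1%N, 1%N => 1
    | 1%N, 0%N, 1%N => 1 | 1%N, 1%N, 0%N => 1
    | 2%N, 0%N, 1%N => - 'i | 2%N, 1%N, 0%N => 'i
    | 3%N, 0%N, 0%N => 1 | 3%N, 1%N, 1%N => -1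
    | _, _, _ => 0
    end.

Definition psd {n} (M : 'M[C]_n) : Prop :=
  adj M = M /\ forall v : 'cV[C]_n, 0 <= (adj v *m M *m v) 0 0.

Definition density {n} (rho : 'M[C]_n) : Prop := psd rho /\ \tr rho = 1.

(* Two-qubit states live on A (x) B = 'I_(2*2), indexed by mxtens_index (a,b),
   consistent with the Kronecker product tensmx ( *t ). *)

Definition ptraceB {m n} (rho : 'M[C]_(m * n)) : 'M[C]_m :=
  \matrix_(i, j) \sum_(k < n) rho (mxtens_index (i, k)) (mxtens_index (j, k)).

Definition corr (rho : 'M[C]_(2 * 2)) (mu nu : 'I_4) : C :=
  \tr ((pauli mu *t pauli nu) *m rho).

Definition Rhat (rho : 'M[C]_(2 * 2)) : 'M[C]_3 :=
  \matrix_(i < 3, j < 3) corr rho (lift ord0 i) (lift ord0 j).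

Definition singular_values {n} (M : 'M[C]_n) (s : 'rV[C]_n) : Prop :=
  (forall i, 0 <= s 0 i) /\
  exists U W : 'M[C]_n, adj U *m U = 1%:M /\ adj W *m W = 1%:M /\
     M = U *m diag_mx s *m W.

Definition orthonormal_basis {m} (a : 'I_m -> 'cV[C]_m) : Prop :=
  forall k l, (adj (a k) *m a l) 0 0 = (k == l)%:R.

Definition ket {m} (k : 'I_m) : 'cV[C]_m := delta_mx k 0.

(* measurement isometry V : A -> A (x) A',  V|a_k> = |a_k>|k> *)
Definition meas_iso {m} (a : 'I_m -> 'cV[C]_m) : 'M[C]_(m * m, m) :=
  \sum_(k < m) (a k *t ket k) *m adj (a k).

Definition measured {m n} (a : 'I_m -> 'cV[C]_m) (rho : 'M[C]_(m * n))
  : 'M[C]_((m * m) * n) :=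
  let W := meas_iso a *t (1%:M : 'M[C]_n) in W *m rho *m adj W.

Definition ptransA' {m n} (X : 'M[C]_((m * m) * n)) : 'M[C]_((m * m) * n) :=
  \matrix_(i, j)
    let: (i1, ib) := mxtens_unindex i in
    let: (ia, ia') := mxtens_unindex i1 in
    let: (j1, jb) := mxtens_unindex j in
    let: (ja, ja') := mxtens_unindex j1 in
    X (mxtens_index (mxtens_index (ia, ja'), ib))
      (mxtens_index (mxtens_index (ja, ia'), jb)).

(* trace norm ||X||_1 = Tr sqrt(X^dagger X) = sum of the square roots of the
   eigenvalues of X^dagger X (spectral_diag of a hermitian matrix lists its
   eigenvalues) *)
Definition trnorm {n} (X : 'M[C]_n) : C :=
  \sum_(i < n) sqrtC (spectral_diag (adj X *m X) 0 i).

Definition negativity_ABA' {m n} (X : 'M[C]_((m * m) * n)) : C :=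
  (trnorm (ptransA' X) - 1) / 2%:R.

End Q.

(* Main.v *)
(* With rho_kl = (<a_k| (x) 1) rho (|a_l> (x) 1), the partial transpose of the
   measured state is sum_kl |a_k, l><a_l, k| (x) rho_kl, so its trace norm is the
   sum of those of the blocks, and the negativity is the trace norm of rho_01.
   A 2x2 matrix M satisfies |M|_1^2 = tr(M^dagger M) + 2 |det M|.  As rho_A is
   maximally mixed, rho_01 = (w.sigma)/4 with w = R^T u and u_i = <a_0|sigma_i|a_1>,
   which gives N^2 = (|w|^2 + |w.w|)/8.  Here u = p + iq for real orthonormal p, q, and
   (|w|^2 + |w.w|)/2 is the largest eigenvalue of R R^T compressed to the plane of
   p and q.  Since any plane arises this way, Courant-Fischer says that the minimum
   is s_2^2: it is reached on the plane orthogonal to a real top eigenvector of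
   R R^T, and any plane contains a vector orthogonal to the bottom eigenvector. *)

Require Import Defs.
From HB Require Import structures.
From mathcomp Require Import all_boot all_order all_algebra.
From mathcomp Require Import mxtens ring.
Import Order.TTheory GRing.Theory Num.Theory.
Local Open Scope ring_scope.

Set Implicit Arguments.
Unset Strict Implicit.
Unset Printing Implicit Defensive.

(** * Trace norm of block matrices *)

Section TraceNorm.
Variable C : numClosedFieldType.

Lemma adjmxM m n p (A : 'M[C]_(m, n)) (B : 'M[C]_(n, p)) :
  adj (A *m B) = adj B *m adj A.
Proof. by rewrite /adj map_mxM trmx_mul. Qed.

Lemma adjmxK m n (A : 'M[C]_(m, n)) : adj (adj A) = A.
Proof. by apply/matrixP=> i j; rewrite !mxE conjCK. Qed.

Lemma adjmx0 m n : adj (0 : 'M[C]_(m, n)) = 0.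
Proof. by rewrite /adj map_mx0 trmx0. Qed.

Lemma adjmxD m n (A B : 'M[C]_(m, n)) : adj (A + B) = adj A + adj B.
Proof. by rewrite /adj map_mxD raddfD. Qed.

Lemma adjmxZ m n (c : C) (A : 'M[C]_(m, n)) : adj (c *: A) = c^* *: adj A.
Proof. by apply/matrixP=> i j; rewrite !mxE rmorphM. Qed.

Lemma adj_sum m n (I : finType) (F : I -> 'M[C]_(m, n)) :
  adj (\sum_i F i) = \sum_i adj (F i).
Proof. exact: (big_morph _ (@adjmxD m n) (adjmx0 m n)). Qed.

Lemma adj_tens m n p q (A : 'M[C]_(m, n)) (B : 'M[C]_(p, q)) :
  adj (A *t B) = adj A *t adj B.
Proof. by rewrite /adj map_mxT trmx_tens. Qed.

Lemma adj_scalar n (c : C) : adj (c%:M : 'M_n) = (c^*)%:M.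
Proof. by rewrite /adj map_scalar_mx tr_scalar_mx. Qed.

Lemma adjmx1 n : adj (1%:M : 'M[C]_n) = 1%:M.
Proof. by rewrite adj_scalar conjC1. Qed.

Lemma adj_mul_ge0 n (v : 'cV[C]_n) : 0 <= (adj v *m v) 0 0.
Proof.
by rewrite mxE sumr_ge0 // => i _; rewrite !mxE mulrC mul_conjC_ge0.
Qed.

Lemma psd_gram m n (T : 'M[C]_(m, n)) : psd (adj T *m T).
Proof.
split=> [|v]; first by rewrite adjmxM adjmxK.
by rewrite mulmxA -adjmxM -mulmxA adj_mul_ge0.
Qed.

Lemma psdD n (A B : 'M[C]_n) : psd A -> psd B -> psd (A + B).
Proof.
move=> [hA pA] [hB pB]; split=> [|v]; first by rewrite adjmxD hA hB.
by rewrite mulmxDr mulmxDl mxE addr_ge0.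
Qed.

Lemma psd_sum n (I : finType) (F : I -> 'M[C]_n) :
  (forall i, psd (F i)) -> psd (\sum_i F i).
Proof.
move=> pF; apply: (big_ind (@psd C n)) => //; last exact: psdD.
by split=> [|v]; rewrite ?adjmx0 // mulmx0 mul0mx mxE.
Qed.

Lemma psdZ n (c : C) (A : 'M[C]_n) : 0 <= c -> psd A -> psd (c *: A).
Proof.
move=> c0 [hA pA]; split=> [|v]; first by rewrite adjmxZ hA conj_Creal ?ger0_real.
by rewrite -scalemxAr -scalemxAl mxE mulr_ge0.
Qed.

Lemma psd_scalar n (c : C) : 0 <= c -> psd (c%:M : 'M_n).
Proof.
move=> c0; rewrite -scalemx1; apply: psdZ => //.
by rewrite -[1%:M]mulmx1 -{1}adjmx1; exact: psd_gram.
Qed.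

(** [S] is Hermitian, hence normal, so the spectral theorem applies; each eigenvalue is the
    quadratic form at the unit eigenvector [adj P *m delta_mx i 0]. *)
Lemma psd_spectral n (S : 'M[C]_n) (P := spectralmx S) (d := spectral_diag S) :
  psd S ->
  [/\ P *m adj P = 1%:M, adj P *m P = 1%:M, forall i, 0 <= d 0 i
    & S = adj P *m diag_mx d *m P].
Proof.
move=> [hS pS].
have PP : P *m adj P = 1%:M.
  by rewrite /adj map_trmx; apply/unitarymxP; exact: spectral_unitarymx.
have PP' := mulmx1C PP.
have SE : S = adj P *m diag_mx d *m P.
  have nS : S \is normalmx.
    by apply/normalmxP; rewrite -map_trmx -/(adj S) hS.
  have /orthomx_spectralP {1}-> := nS.
  by rewrite invmx_unitary ?spectral_unitarymx // -map_trmx.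
split=> // i.
have := pS (adj P *m delta_mx i 0).
rewrite {1}SE adjmxM adjmxK !mulmxA -[_ *m P *m adj P]mulmxA PP mulmx1.
rewrite -[_ *m P *m adj P]mulmxA PP mulmx1.
rewrite mul_mx_diag mxE (bigD1 i) //= big1 => [|j ji].
  by rewrite !mxE !eqxx /= conjC1 mul1r mulr1 addr0.
by rewrite !mxE (negPf ji) mulr0.
Qed.

Lemma psd_factor n (S : 'M[C]_n) : psd S -> exists T : 'M[C]_n, S = adj T *m T.
Proof.
move=> /psd_spectral; set P := spectralmx S; set d := spectral_diag S.
move=> [_ _ d0 SE].
exists (diag_mx (map_mx sqrtC d) *m P); rewrite adjmxM -mulmxA [adj _ *m (_ *m P)]mulmxA.
rewrite {1}SE -mulmxA; congr (_ *m (_ *m _)).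
rewrite mul_mx_diag; apply/matrixP=> i j; rewrite !mxE.
have [->|_] := eqVneq j i; last by rewrite !mulr0n conjC0 mul0r.
rewrite !mulr1n conj_Creal; first by rewrite -expr2 sqrtCK.
by rewrite ger0_real // sqrtC_ge0.
Qed.

(* If U† diag(e) U = P† diag(d)^2 P, the unitary Z = U P† intertwines diag(e)
   and diag(d)^2, hence entrywise also their nonnegative square roots. *)
Lemma trnorm_sqrt n (Y S : 'M[C]_n) :
  psd S -> S *m S = adj Y *m Y -> trnorm Y = \tr S.
Proof.
move=> /psd_spectral; set P := spectralmx S; set d := spectral_diag S.
move=> [PP PP' d0 SE] SS.
have [] := psd_spectral (psd_gram Y).
rewrite /trnorm; move: (spectralmx _) (spectral_diag _) => U e UU UU' e0 YE.
pose Z := U *m adj P.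
have ZZ : adj Z *m Z = 1%:M.
  by rewrite adjmxM adjmxK -mulmxA [adj U *m _]mulmxA UU' mul1mx.
have eZ : diag_mx e *m Z = Z *m (diag_mx d *m diag_mx d).
  have -> : diag_mx d *m diag_mx d = P *m S *m S *m adj P.
    have <- : P *m S *m adj P = diag_mx d.
      by rewrite SE !mulmxA PP mul1mx -mulmxA PP mulmx1.
    by rewrite !mulmxA -[P *m S *m adj P *m P]mulmxA PP' mulmx1.
  rewrite -[P *m S *m S]mulmxA SS YE /Z !mulmxA -[U *m adj P *m P]mulmxA PP' mulmx1.
  by rewrite UU mul1mx.
clearbody Z.
have sZ : diag_mx (map_mx sqrtC e) *m Z = Z *m diag_mx d.
  apply/matrixP=> i j; move/matrixP/(_ i j): eZ; rewrite mulmxA.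
  rewrite !mul_diag_mx !mul_mx_diag 6!mxE.
  have [->|z0] := eqVneq (Z i j) 0; first by rewrite !(mulr0, mul0r).
  move=> h; rewrite mulrC; congr (_ * _); suff -> : e 0 i = d 0 j ^+ 2.
    by rewrite sqrCK.
  by apply: (mulfI z0); rewrite mulrC h expr2 mulrA.
transitivity (\tr (diag_mx (map_mx sqrtC e))).
  by rewrite mxtrace_diag; apply: eq_bigr => i _; rewrite mxE.
have -> : diag_mx (map_mx sqrtC e) = Z *m diag_mx d *m adj Z.
  by rewrite -sZ -mulmxA (mulmx1C ZZ) mulmx1.
by rewrite mxtrace_mulC mulmxA ZZ mul1mx [in RHS]SE mxtrace_mulC mulmxA PP mul1mx.
Qed.

Lemma tens_mxDl m n p q (A B : 'M[C]_(m, n)) (D : 'M[C]_(p, q)) :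
  (A + B) *t D = A *t D + B *t D.
Proof. by apply/matrixP=> i j; rewrite !mxE mulrDl. Qed.

Lemma tens_mx_suml m n p q (I : finType) (F : I -> 'M[C]_(m, n)) (D : 'M[C]_(p, q)) :
  (\sum_i F i) *t D = \sum_i (F i *t D).
Proof.
by apply: (big_morph (fun A => A *t D)) => [A B|]; rewrite ?tens_mxDl ?tens0mx.
Qed.

Lemma mxtrace_tens m n (A : 'M[C]_m) (B : 'M[C]_n) : \tr (A *t B) = \tr A * \tr B.
Proof.
by rewrite /mxtrace mulr_sum; apply: eq_bigr => i _; rewrite !mxE.
Qed.

Definition orthonormal_family (I : finType) N (e : I -> 'cV[C]_N) : Prop :=
  forall i j, adj (e i) *m e j = (i == j)%:R%:M.

(** Orthonormality kills all cross terms, so the positive matrix [\sum_i (e i *m adj (e i)) *t S i]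
    squares to the Gram matrix of the block sum: it is its absolute value. *)
Lemma trnorm_blocks (I : finType) N n (e f : I -> 'cV[C]_N) (B S : I -> 'M[C]_n) :
  orthonormal_family e -> orthonormal_family f ->
  (forall i, psd (S i)) -> (forall i, S i *m S i = adj (B i) *m B i) ->
  trnorm (\sum_i (f i *m adj (e i)) *t B i) = \sum_i \tr (S i).
Proof.
move=> he hf pS SB.
have mulE (x y : I -> 'cV[C]_N) (F G : I -> 'M[C]_n) :
  orthonormal_family y ->
  (\sum_i (x i *m adj (y i)) *t F i) *m (\sum_i (y i *m adj (x i)) *t G i)
  = \sum_i (x i *m adj (x i)) *t (F i *m G i).
  move=> hy; rewrite mulmx_suml; apply: eq_bigr => i _.
  rewrite mulmx_sumr (bigD1 i) //= big1 ?addr0 => [|j ji].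
    rewrite tensmx_mul mulmxA -[x i *m _ *m _]mulmxA hy eqxx.
    by rewrite mulmx1.
  rewrite tensmx_mul mulmxA -[x i *m _ *m _]mulmxA hy eq_sym (negPf ji).
  by rewrite raddf0 mulmx0 mul0mx tens0mx.
rewrite (@trnorm_sqrt _ _ (\sum_i (e i *m adj (e i)) *t S i)).
- rewrite [LHS]raddf_sum; apply: eq_bigr => i _.
  by rewrite /= mxtrace_tens mxtrace_mulC he eqxx mxtrace1 mul1r.
- apply: psd_sum => i; have [T ->] := psd_factor (pS i).
  suff -> : (e i *m adj (e i)) *t (adj T *m T)
      = adj (adj (e i) *t T) *m (adj (e i) *t T) by exact: psd_gram.
  by rewrite adj_tens adjmxK tensmx_mul.
- rewrite mulE // adj_sum.
  under [X in _ = X *m _]eq_bigr => i _ do rewrite adj_tens adjmxM adjmxK.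
  by rewrite mulE //; apply: eq_bigr => i _; rewrite SB.
Qed.

End TraceNorm.

(** * Blocks of the measured state *)

Section Blocks.
Variable C : numClosedFieldType.

(* The type relies on 1 * 2 being convertible to 2. *)
Definition block m (a b : 'cV[C]_m) (rho : 'M[C]_(m * 2)) : 'M[C]_2 :=
  (adj a *t (1%:M : 'M_2)) *m rho *m (b *t (1%:M : 'M_2)).

Lemma tens1mx (M : 'M[C]_2) : (1%:M : 'M[C]_1) *t M = M.
Proof. by rewrite tens_scalar_mx scale1r castmx_id. Qed.

Lemma measured_blocks m (a : 'I_m -> 'cV[C]_m) (rho : 'M[C]_(m * 2)) :
  measured a rho = \sum_k \sum_l
    ((a k *t ket C k) *m adj (a l *t ket C l)) *t block (a k) (a l) rho.
Proof.
rewrite /measured /meas_iso tens_mx_suml adj_sum mulmx_suml mulmx_suml.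
apply: eq_bigr => k _; rewrite mulmx_sumr; apply: eq_bigr => l _.
set c := _ *t ket C k; set c' := _ *t ket C l.
(* Tensored with the 1x1 identity, the block can be absorbed by the mixed product rule. *)
transitivity ((c *t (1%:M : 'M_2)) *m ((1%:M : 'M_1) *t block (a k) (a l) rho)
   *m (adj c' *t (1%:M : 'M_2))); last by rewrite !tensmx_mul mulmx1 mul1mx mulmx1.
have -> : (c *m adj (a k)) *t (1%:M : 'M[C]_2) = (c *t 1%:M) *m (adj (a k) *t 1%:M).
  by rewrite tensmx_mul mulmx1.
have -> : (c' *m adj (a l)) *t (1%:M : 'M[C]_2) = (c' *t 1%:M) *m (adj (a l) *t 1%:M).
  by rewrite tensmx_mul mulmx1.
by rewrite adjmxM !adj_tens adjmxK !adjmx1 tens1mx /block !mulmxA.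
Qed.

Lemma ptransA'_tens m n (A B : 'M[C]_m) (D : 'M[C]_n) :
  ptransA' (A *t B *t D) = A *t B^T *t D.
Proof.
apply/matrixP=> i j; case: (mxtens_indexP i) => i1 ib; case: (mxtens_indexP i1) => ia ia'.
case: (mxtens_indexP j) => j1 jb; case: (mxtens_indexP j1) => ja ja'.
by rewrite !tensmxE !mxE !mxtens_indexK !tensmxE.
Qed.

Lemma ptransA'_sum m n (I : finType) (F : I -> 'M[C]_(m * m * n)) :
  ptransA' (\sum_i F i) = \sum_i ptransA' (F i).
Proof.
by apply/matrixP=> i j; rewrite mxE /= !summxE; apply: eq_bigr => k _; rewrite mxE.
Qed.

(** The transpose on A' exchanges the two kets, whose entries are real. Each block then sits between
    product basis vectors with swapped index pairs, the shape that [trnorm_blocks] takes. *)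
Lemma ptransA'_measured m (a : 'I_m -> 'cV[C]_m) (rho : 'M[C]_(m * 2)) :
  ptransA' (measured a rho) = \sum_(p : 'I_m * 'I_m)
    ((a p.1 *t ket C p.2) *m adj (a p.2 *t ket C p.1)) *t block (a p.1) (a p.2) rho.
Proof.
rewrite measured_blocks pair_big /= ptransA'_sum; apply: eq_bigr => -[k l] _ /=.
rewrite !adj_tens !tensmx_mul ptransA'_tens; congr (_ *t _ *t _).
by rewrite trmx_mul; congr (_ *m _); apply/matrixP=> i j; rewrite !mxE conjC_nat.
Qed.

Lemma orthonormal_tens_ket m (a : 'I_m -> 'cV[C]_m) : orthonormal_basis a ->
  orthonormal_family (fun p : 'I_m * 'I_m => a p.1 *t ket C p.2).
Proof.
move=> ha [k k'] [l l'] /=.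
transitivity ((adj (a k) *m a l) *t (adj (ket C k') *m ket C l')).
  by rewrite -tensmx_mul -adj_tens.
have -> : adj (a k) *m a l = (k == l)%:R%:M by rewrite [LHS]mx11_scalar ha.
have -> : adj (ket C k') *m ket C l' = (k' == l')%:R%:M.
  rewrite [LHS]mx11_scalar mxE (bigD1 l') //= big1 => [|q ql].
    by rewrite !mxE !eqxx mulr1 addr0 andbT conjC_nat eq_sym.
  by rewrite !mxE (negPf ql) mulr0.
by rewrite tens_scalar_mx castmx_id scale_scalar_mx -natrM mulnb.
Qed.

(** * Absolute value of a 2x2 matrix *)

Lemma sum_ord2 (V : nmodType) (F : 'I_2 -> V) : \sum_i F i = F 0 + F 1.
Proof. by rewrite !big_ord_recl big_ord0 addr0; congr (_ + F _); apply: val_inj. Qed.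

Lemma ord2P (i : 'I_2) : i = 0 \/ i = 1.
Proof. by case: i => [[|[|[]]]] // hi; [left | right]; apply: val_inj. Qed.

Lemma det_mx2 (A : 'M[C]_2) : \det A = A 0 0 * A 1 1 - A 0 1 * A 1 0.
Proof.
rewrite (expand_det_row _ 0) sum_ord2 /cofactor !det_mx11 !mxE expr0 expr1 mul1r mulN1r mulrN.
by congr (_ * A _ _ - _ * A _ _); apply: val_inj.
Qed.

Lemma mxtrace2 (A : 'M[C]_2) : \tr A = A 0 0 + A 1 1.
Proof. exact: sum_ord2. Qed.

Lemma Cayley_Hamilton2 (N : 'M[C]_2) : N *m N = \tr N *: N - (\det N)%:M.
Proof.
apply/matrixP=> i j; rewrite det_mx2 mxtrace2 !mxE sum_ord2.
by case: (ord2P i) (ord2P j) => -> [] ->; rewrite /= ?mulr1n ?mulr0n; ring.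
Qed.

Lemma mxtrace_gram m n (M : 'M[C]_(m, n)) :
  \tr (adj M *m M) = \sum_i \sum_j `|M j i| ^+ 2.
Proof.
apply: eq_bigr => i _; rewrite mxE; apply: eq_bigr => j _.
by rewrite !mxE normCK mulrC.
Qed.

Lemma mxtrace_gram_eq0 m n (M : 'M[C]_(m, n)) : \tr (adj M *m M) = 0 -> M = 0.
Proof.
rewrite mxtrace_gram => /eqP; rewrite psumr_eq0 => [/allP h|i _]; last first.
  by rewrite sumr_ge0 // => j _; rewrite exprn_ge0.
apply/matrixP=> j i; rewrite mxE.
have /eqP/eqP := h i (mem_index_enum i); rewrite psumr_eq0 => [/allP|k _]; last first.
  by rewrite exprn_ge0.
by move=> /(_ j (mem_index_enum j)); rewrite /= sqrf_eq0 normr_eq0 => /eqP.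
Qed.

(** For N = M^dagger M and x = |det M|, det N = x^2 and Cayley-Hamilton give (N + x)^2 = (tr N + 2x)
    N, so (N + x)/t with t^2 = tr N + 2x is the root of N. *)
Lemma sqrt_gram2 (M : 'M[C]_2) : exists S : 'M[C]_2,
  [/\ psd S, S *m S = adj M *m M
    & \tr S = sqrtC (\tr (adj M *m M) + 2 * `|\det M|)].
Proof.
set N := adj M *m M; set x := `|\det M|; set t := sqrtC _.
have x0 : 0 <= x by exact: normr_ge0.
have N0 : 0 <= \tr N.
  by rewrite mxtrace_gram sumr_ge0 // => i _; rewrite sumr_ge0 // => j _; rewrite exprn_ge0.
have t0 : 0 <= t by rewrite sqrtC_ge0 addr_ge0 ?mulr_ge0.
have t2 : t ^+ 2 = \tr N + 2 * x by rewrite sqrtCK.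
have dN : \det N = x ^+ 2.
  by rewrite det_mulmx /adj det_tr det_map_mx normCK mulrC.
exists (t^-1 *: (N + x%:M)); split.
- by apply: psdZ; rewrite ?invr_ge0 //; apply: psdD; [exact: psd_gram | exact: psd_scalar].
- rewrite -scalemxAl -scalemxAr scalerA.
  have -> : (N + x%:M) *m (N + x%:M) = t ^+ 2 *: N.
    rewrite mulmxDl !mulmxDr Cayley_Hamilton2 dN mul_mx_scalar !mul_scalar_mx t2.
    by apply/matrixP=> i j; rewrite !mxE; case: (i == j); rewrite ?mulr1n ?mulr0n; ring.
  (* For t = 0 the inverse defaults to 0 and so does the candidate root; t^2 = 0 forces tr N = 0,
     hence M = 0. *)
  have [tz|tn] := eqVneq t 0; last by rewrite scalerA -expr2 -exprMn mulVf // expr1n scale1r.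
  suff -> : N = 0 by rewrite !scaler0.
  suff M0 : M = 0 by rewrite /N M0 mulmx0.
  apply: mxtrace_gram_eq0; apply/eqP; move/eqP: t2.
  by rewrite tz expr0n /= eq_sym paddr_eq0 ?mulr_ge0 // => /andP[].
- rewrite mxtraceZ mxtraceD mxtrace_scalar -mulr_natl -t2.
  by have [->|tn] := eqVneq t 0; rewrite ?invr0 ?mul0r // expr2 mulKf.
Qed.
End Blocks.

(** * Negativity through the off-diagonal block *)

Section Negativity.
Variable C : numClosedFieldType.

Lemma sum_mxtens (V : nmodType) m n (F : 'I_(m * n) -> V) :
  \sum_x F x = \sum_i \sum_j F (mxtens_index (i, j)).
Proof.
rewrite pair_big /= (reindex (@mxtens_index m n)) /=.
  by apply: eq_bigr => -[i j].
by exists (@mxtens_unindex m n) => x _; rewrite ?mxtens_indexK ?mxtens_unindexK.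
Qed.

Lemma mxtens_unindex2 (i : 'I_(1 * 2)) : mxtens_unindex i = (0, i : 'I_2).
Proof. by rewrite -[RHS]mxtens_indexK; congr mxtens_unindex; apply: val_inj. Qed.

Lemma blockE m (a b : 'cV[C]_m) (rho : 'M[C]_(m * 2)) i j :
  block a b rho i j =
  \sum_p \sum_q (a p 0)^* * rho (mxtens_index (p, i)) (mxtens_index (q, j)) * b q 0.
Proof.
rewrite /block mxE sum_mxtens exchange_big /= exchange_big /=.
under eq_bigr => q _.
  rewrite (bigD1 j) //= big1 => [|k kj]; last first.
    rewrite [(_ *t _) _ _]mxE mxtens_indexK mxtens_unindex2 /= [_%:M _ _]mxE.
    by rewrite (negPf kj) !mulr0.
  rewrite [(b *t _) _ _]mxE mxtens_indexK mxtens_unindex2 /= [_%:M _ _]mxE eqxx.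
  rewrite mulr1 addr0 mxE sum_mxtens mulr_suml.
  over.
rewrite exchange_big /=; apply: eq_bigr => p _; apply: eq_bigr => q _.
rewrite (bigD1 i) //= big1 => [|k ki]; last first.
  rewrite [(_ *t _) _ _]mxE mxtens_indexK mxtens_unindex2 /= [_%:M _ _]mxE.
  by rewrite eq_sym (negPf ki) !(mulr0, mul0r).
rewrite [(adj _ *t _) _ _]mxE mxtens_indexK mxtens_unindex2 /= [_%:M _ _]mxE eqxx.
by rewrite mulr1 addr0 !mxE.
Qed.

Lemma tr_block m (a b : 'cV[C]_m) (rho : 'M[C]_(m * 2)) :
  \tr (block a b rho) = (adj a *m ptraceB rho *m b) 0 0.
Proof.
rewrite /mxtrace; under eq_bigr => i _ do rewrite blockE exchange_big /=.
rewrite exchange_big /= mxE; apply: eq_bigr => q _.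
rewrite exchange_big /= mxE mulr_suml; apply: eq_bigr => p _.
by rewrite !mxE mulr_sumr mulr_suml.
Qed.

Lemma adj_block m (a b : 'cV[C]_m) (rho : 'M[C]_(m * 2)) :
  adj rho = rho -> adj (block a b rho) = block b a rho.
Proof.
move=> h; transitivity (adj (b *t (1%:M : 'M_2))
    *m (adj rho *m adj (adj a *t (1%:M : 'M_2)))); first by rewrite -!adjmxM.
by rewrite h !adj_tens adjmxK !adjmx1 mulmxA.
Qed.

Lemma psd_block m (a : 'cV[C]_m) (rho : 'M[C]_(m * 2)) :
  psd rho -> psd (block a a rho).
Proof.
move=> [h p]; split=> [|v]; first exact: adj_block.
have -> : adj v *m block a a rho *m v
   = adj ((a *t (1%:M : 'M_2)) *m v) *m rho *m ((a *t (1%:M : 'M_2)) *m v).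
  transitivity (adj v *m adj (a *t (1%:M : 'M_2)) *m rho *m (a *t (1%:M : 'M_2)) *m v).
    by rewrite adj_tens adjmx1 /block !mulmxA.
  by rewrite adjmxM !mulmxA.
exact: p.
Qed.

(** The diagonal blocks are positive of trace 1/2, so together they cancel the -1; the two
    off-diagonal blocks are adjoint, with equal trace norms, and the division by 2 keeps one of
    them. *)
Lemma negativity_qubit (a : 'I_2 -> 'cV[C]_2) (rho : 'M[C]_(2 * 2))
    (M := block (a 0) (a 1) rho) :
  density rho -> ptraceB (n := 2) rho = (2%:R)^-1%:M -> orthonormal_basis a ->
  negativity_ABA' (measured (n := 2) a rho)
  = sqrtC (\tr (adj M *m M) + 2 * `|\det M|).
Proof.
move=> [psd_rho _] rhoA ha.
have MM : block (a 1) (a 0) rho = adj M by rewrite adj_block //; case: psd_rho.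
have tr_diag k : \tr (block (a k) (a k) rho) = 2^-1.
  by rewrite tr_block rhoA mul_mx_scalar -scalemxAl mxE ha eqxx mulr1.
have [S [pS SS tS]] := sqrt_gram2 M.
have [S' [pS' SS' tS']] := sqrt_gram2 (adj M).
pose T (p : 'I_2 * 'I_2) := if p.1 == p.2 then block (a p.1) (a p.1) rho
  else if p.1 == 0 then S else S'.
rewrite /negativity_ABA' ptransA'_measured (@trnorm_blocks _ _ _ _ _ _ _ T).
- rewrite -(pair_bigA _ (fun i j => \tr (T (i, j)))) /= !sum_ord2 /T /= !tr_diag tS tS'.
  rewrite adjmxK mxtrace_mulC /adj det_tr det_map_mx norm_conjC -/(adj M).
  by field.
- move=> p q; have := orthonormal_tens_ket ha (p.2, p.1) (q.2, q.1).
  by rewrite /= xpair_eqE andbC -xpair_eqE -!surjective_pairing.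
- exact: orthonormal_tens_ket.
- move=> [i j]; rewrite /T /=; case: ifP => _; first exact: psd_block.
  by case: ifP.
- move=> [i j]; rewrite /T /=; case: (ord2P i) (ord2P j) => -> [] -> //=.
  + by rewrite adj_block //; case: psd_rho.
  + by rewrite MM.
  + by rewrite adj_block //; case: psd_rho.
Qed.
End Negativity.

(** * Pauli coordinates of the off-diagonal block *)

Section Bloch.
Variable C : numClosedFieldType.

Lemma sum_ord3 (V : nmodType) (F : 'I_3 -> V) : \sum_i F i = F 0 + F 1 + F ord_max.
Proof.
rewrite !big_ord_recl big_ord0 addr0 addrA.
by congr (_ + F _ + F _); apply: val_inj.
Qed.

Lemma sum_ord4 (V : nmodType) (F : 'I_4 -> V) :
  \sum_i F i = F ord0 + \sum_(i < 3) F (lift ord0 i).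
Proof. by rewrite big_ord_recl. Qed.

Lemma adj_pauli (mu : 'I_4) : adj (pauli C mu) = pauli C mu.
Proof.
apply/matrixP=> i j; rewrite !mxE.
case: mu => [[|[|[|[|//]]]] hmu]; case: (ord2P i) (ord2P j) => -> [] -> /=;
  by rewrite ?conjC0 ?conjC1 ?rmorphN /= ?conjC1 ?conjCi ?opprK.
Qed.

(** The trace of a product of two Hermitian matrices is real: the adjoint reverses the product and
    cyclicity restores it. *)
Lemma Rhat_real (rho : 'M[C]_(2 * 2)) : adj rho = rho -> map_mx Num.conj (Rhat rho) = Rhat rho.
Proof.
move=> h; apply/matrixP=> i j; rewrite !mxE /corr.
have conj_tr n (X : 'M[C]_n) : (\tr X)^* = \tr (adj X).
  by rewrite mxtrace_tr /mxtrace rmorph_sum; apply: eq_bigr => k _; rewrite mxE.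
by rewrite conj_tr adjmxM adj_tens !adj_pauli h mxtrace_mulC.
Qed.

Lemma pauli_expansion (X : 'M[C]_2) :
  X = 2^-1 *: \sum_mu \tr (pauli C mu *m X) *: pauli C mu.
Proof.
apply/matrixP=> i j; rewrite sum_ord4 sum_ord3 !mxE !mxtrace2 !mxE !sum_ord2 !mxE /=.
have i2 := sqrCi C.
by case: (ord2P i) (ord2P j) => -> [] -> /=; field: i2.
Qed.

Lemma pauli0 : pauli C ord0 = 1%:M.
Proof. by apply/matrixP=> i j; rewrite !mxE; case: (ord2P i) (ord2P j) => -> [] ->. Qed.

Lemma tens_mxZl m n p q (c : C) (A : 'M[C]_(m, n)) (B : 'M[C]_(p, q)) :
  (c *: A) *t B = c *: (A *t B).
Proof. by apply/matrixP=> i j; rewrite !mxE mulrA. Qed.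

Lemma tr_block_mul (a b : 'cV[C]_2) (rho : 'M[C]_(2 * 2)) (X : 'M[C]_2) :
  \tr (block a b rho *m X) = \tr (((b *m adj a) *t X) *m rho).
Proof.
have -> : (b *m adj a) *t X = (b *t (1%:M : 'M_2)) *m X *m (adj a *t (1%:M : 'M_2)).
  transitivity ((b *t (1%:M : 'M_2)) *m ((1%:M : 'M_1) *t X) *m (adj a *t (1%:M : 'M_2))).
    by rewrite !tensmx_mul !mulmx1 mul1mx.
  by rewrite tens1mx.
by rewrite [RHS]mxtrace_mulC !mulmxA [RHS]mxtrace_mulC /block !mulmxA.
Qed.

(** The vector u of the overview; for an orthonormal basis, its real and imaginary parts span the
    plane orthogonal to the usual (real) Bloch vector of [a 0]. *)
Definition bloch (a : 'I_2 -> 'cV[C]_2) : 'cV[C]_3 :=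
  \col_i (adj (a 0) *m pauli C (lift ord0 i) *m a 1) 0 0.

(** In the Pauli expansion of [a 1 *m adj (a 0)] the identity has coefficient <a_0|a_1>/2 = 0, which
    is why only [Rhat] enters. *)
Lemma tr_block_pauli (a : 'I_2 -> 'cV[C]_2) (rho : 'M[C]_(2 * 2)) (j : 'I_3) :
  orthonormal_basis a ->
  \tr (block (a 0) (a 1) rho *m pauli C (lift ord0 j))
  = 2^-1 * ((Rhat rho)^T *m bloch a) j 0.
Proof.
move=> ha; rewrite tr_block_mul [X in X *t _]pauli_expansion tens_mxZl.
have trE mu : \tr (pauli C mu *m (a 1 *m adj (a 0))) = (adj (a 0) *m pauli C mu *m a 1) 0 0.
  by rewrite mulmxA mxtrace_mulC mulmxA /mxtrace big_ord1.
rewrite -scalemxAl mxtraceZ tens_mx_suml mulmx_suml [\tr _]raddf_sum /= sum_ord4 trE pauli0.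
rewrite mulmx1 ha scale0r tens0mx mul0mx mxtrace0 add0r; congr (_ * _); rewrite mxE.
by apply: eq_bigr => i _; rewrite trE tens_mxZl -scalemxAl mxtraceZ !mxE mulrC.
Qed.

(** A traceless M is (tau.sigma)/2, so tr(M^dagger M) = |tau|^2/2 and det M = -(tau.tau)/4. *)
Lemma gram_pauli (M : 'M[C]_2) (tau := fun j => \tr (M *m pauli C (lift ord0 j))) :
  \tr M = 0 -> \tr (adj M *m M) + 2 * `|\det M|
    = 2^-1 * (\sum_j `|tau j| ^+ 2 + `|\sum_j tau j ^+ 2|).
Proof.
move=> M0; have M11 : M 1 1 = - M 0 0.
  by apply/eqP; rewrite -addr_eq0 addrC -mxtrace2 M0.
rewrite mxtrace_gram det_mx2 !sum_ord3 !sum_ord2 /tau !mxtrace2 !mxE !sum_ord2 !mxE /= M11.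
move: (M 0 0) (M 0 1) (M 1 0) => x y z; have i2 := sqrCi C.
have -> : x * 0 + y * 'i + (z * - 'i + - x * 0) = 'i * (y - z) by ring.
have -> : x * - x - y * z = - 4^-1 * ((x * 0 + y * 1 + (z * 1 + - x * 0)) ^+ 2
  + ('i * (y - z)) ^+ 2 + (x * 1 + y * 0 + (z * 0 + - x * -1)) ^+ 2) by field: i2.
rewrite !normrM normCi !normrN normfV normr_nat.
move: `|_ + _ + _| => d.
have -> : x * 0 + y * 1 + (z * 1 + - x * 0) = y + z by ring.
have -> : x * 1 + y * 0 + (z * 0 + - x * -1) = 2 * x by ring.
by rewrite mul1r !normCK; field.
Qed.
End Bloch.

(** * Hermitian and bilinear squares of the vector u *)

Section BlochVector.
Variable C : numClosedFieldType.

Definition sqnorm n (x : 'cV[C]_n) : C := \sum_i (x i 0)^* * x i 0.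
(** The bilinear square, without conjugation. For u = p + iq it is |p|^2 - |q|^2 + 2i p.q, so
    [sqsum u = 0] and [sqnorm u = 2] together say that p and q are orthonormal. *)
Definition sqsum n (x : 'cV[C]_n) : C := \sum_i x i 0 ^+ 2.

Lemma orthonormal_basis2 (a : 'I_2 -> 'cV[C]_2) : orthonormal_basis a <->
  [/\ (a 0 0 0)^* * a 0 0 0 + (a 0 1 0)^* * a 0 1 0 = 1,
      (a 1 0 0)^* * a 1 0 0 + (a 1 1 0)^* * a 1 1 0 = 1
    & (a 0 0 0)^* * a 1 0 0 + (a 0 1 0)^* * a 1 1 0 = 0].
Proof.
have E k l : (adj (a k) *m a l) 0 0 = (a k 0 0)^* * a l 0 0 + (a k 1 0)^* * a l 1 0.
  by rewrite mxE sum_ord2 !mxE.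
split=> [h|[h00 h11 h01] k l]; first by rewrite -!E !h.
rewrite E; case: (ord2P k) (ord2P l) => -> [] -> //=.
by rewrite -[RHS]conjC0 -[in RHS]h01 rmorphD !rmorphM /= !conjCK mulrC [in X in _ + X]mulrC.
Qed.

Lemma blochE (a : 'I_2 -> 'cV[C]_2) :
  [/\ bloch a 0 0 = (a 0 0 0)^* * a 1 1 0 + (a 0 1 0)^* * a 1 0 0,
      bloch a 1 0 = 'i * ((a 0 1 0)^* * a 1 0 0 - (a 0 0 0)^* * a 1 1 0)
    & bloch a ord_max 0 = (a 0 0 0)^* * a 1 0 0 - (a 0 1 0)^* * a 1 1 0].
Proof. by split; rewrite !mxE sum_ord2 !mxE !sum_ord2 !mxE /=; ring. Qed.

Lemma sqnorm_bloch (a : 'I_2 -> 'cV[C]_2) : orthonormal_basis a -> sqnorm (bloch a) = 2.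
Proof.
move=> /orthonormal_basis2; have [] := blochE a; rewrite /sqnorm sum_ord3 => -> -> ->.
move: (a 0 0 0) (a 0 1 0) (a 1 0 0) (a 1 1 0) => x y z t [h0 h1 h01].
have i2 : 'i^* * 'i = 1 :> C by rewrite mulrC -normCK normCi expr1n.
(* The sum of the sigma_i (x) sigma_i is twice the swap minus the identity, whence |u|^2 =
   2|a_0|^2|a_1|^2 - |<a_0|a_1>|^2. *)
transitivity (2 * (x^* * x + y^* * y) * (z^* * z + t^* * t)
  - (x^* * z + y^* * t) * (x^* * z + y^* * t)^*); last by rewrite h0 h1 h01 mul0r subr0 !mulr1.
by rewrite !(rmorphM, rmorphD, rmorphN) /= !conjCK; ring: i2.
Qed.

Lemma sqsum_bloch (a : 'I_2 -> 'cV[C]_2) : orthonormal_basis a -> sqsum (bloch a) = 0.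
Proof.
move=> /orthonormal_basis2; have [] := blochE a; rewrite /sqsum sum_ord3 => -> -> ->.
move: (a 0 0 0) (a 0 1 0) (a 1 0 0) (a 1 1 0) => x y z t [_ _ h01].
have i2 := sqrCi C.
(* The same identity without conjugation gives u.u = <a_0|a_1>^2. *)
transitivity ((x^* * z + y^* * t) ^+ 2); first by ring: i2.
by rewrite h01 expr0n.
Qed.

(** The maximally mixed marginal makes M traceless; 1/8 is the 1/2 of [gram_pauli] times the square
    of the 1/2 in [tr_block_pauli]. *)
Lemma gram_off_block (a : 'I_2 -> 'cV[C]_2) (rho : 'M[C]_(2 * 2))
    (M := block (a 0) (a 1) rho) (w := (Rhat rho)^T *m bloch a) :
  ptraceB (n := 2) rho = (2%:R)^-1%:M -> orthonormal_basis a ->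
  \tr (adj M *m M) + 2 * `|\det M| = 8^-1 * (sqnorm w + `|sqsum w|).
Proof.
move=> rhoA ha.
rewrite gram_pauli; last first.
  by rewrite tr_block rhoA mul_mx_scalar -scalemxAl mxE ha mulr0.
have tauE j : \tr (M *m pauli C (lift ord0 j)) = 2^-1 * w j 0.
  exact: tr_block_pauli.
under eq_bigr do rewrite tauE; under [X in `|X|]eq_bigr do rewrite tauE exprMn.
rewrite -mulr_sumr normrM -/(sqsum w).
under eq_bigr do rewrite normrM exprMn; rewrite -mulr_sumr.
have -> : \sum_i `|w i 0| ^+ 2 = sqnorm w.
  by apply: eq_bigr => i _; rewrite normCK mulrC.
by rewrite normrX !normfV !normr_nat; field.
Qed.

End BlochVector.

(** * The second singular value *)

Section MinMax.
Variable C : numClosedFieldType.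

Lemma sqnormE n (x : 'cV[C]_n) : sqnorm x = (adj x *m x) 0 0.
Proof. by rewrite mxE; apply: eq_bigr => i _; rewrite !mxE. Qed.

Lemma sqnorm_unitary n (U : 'M[C]_n) (x : 'cV[C]_n) :
  U *m adj U = 1%:M -> sqnorm (adj U *m x) = sqnorm x.
Proof. by move=> UU; rewrite !sqnormE adjmxM adjmxK mulmxA -[_ *m U *m _]mulmxA UU mulmx1. Qed.

(** These combinations of u and its conjugate fill the complexified plane of p and q. A real matrix
    maps them to the same combinations of w, so the formula measures both sides. *)
Lemma sqnorm_conj_comb n (x : 'cV[C]_n) (c d : C) (z := c^* * d * (sqsum x)^*) :
  sqnorm (c *: x + d *: map_mx Num.conj x) = (c^* * c + d^* * d) * sqnorm x + (z + z^*).
Proof.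
rewrite {}/z /sqnorm /sqsum rmorphM !rmorph_sum !mulr_sumr -!big_split /=.
apply: eq_bigr => i _; rewrite !mxE !(rmorphM, rmorphD, rmorphXn) /= !conjCK.
by ring.
Qed.

Lemma adj_diag n (s : 'rV[C]_n) :
  (forall i, 0 <= s 0 i) -> adj (diag_mx s) = diag_mx s.
Proof.
move=> s0; apply/matrixP=> j k; rewrite !mxE eq_sym.
case: eqVneq => [->|_]; last by rewrite conjC0.
by rewrite mulr1n conj_Creal // ger0_real.
Qed.

(** The unitary [W] drops out, leaving the quadratic form of R R^dagger in its eigenbasis, the
    columns of [U]. *)
Lemma sqnorm_svd n (R U W : 'M[C]_n) (s : 'rV[C]_n) (v : 'cV[C]_n) :
  (forall i, 0 <= s 0 i) -> adj W *m W = 1%:M -> R = U *m diag_mx s *m W ->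
  sqnorm (adj R *m v) = \sum_i s 0 i ^+ 2 * `|(adj U *m v) i 0| ^+ 2.
Proof.
move=> s0 /mulmx1C WW ->; rewrite !adjmxM -!mulmxA sqnorm_unitary //.
apply: eq_bigr => i _; set y := adj U *m v.
rewrite adj_diag // mul_diag_mx mxE rmorphM /= (conj_Creal (x := s 0 i)) ?ger0_real // normCK.
by ring.
Qed.

Lemma addC_conj_le (z : C) : z + z^* <= 2 * `|z|.
Proof.
have zr : z + z^* \is Num.real by apply/CrealP; rewrite rmorphD /= conjCK addrC.
apply: le_trans (real_ler_norm zr) _; apply: le_trans (ler_normD _ _) _.
by rewrite norm_conjC mulr_natl mulr2n.
Qed.

Lemma mul_norm_le (c d : C) : 2 * (`|c| * `|d|) <= `|c| ^+ 2 + `|d| ^+ 2.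
Proof.
rewrite -subr_ge0.
have -> : `|c| ^+ 2 + `|d| ^+ 2 - 2 * (`|c| * `|d|) = (`|c| - `|d|) ^+ 2 by ring.
by rewrite -realEsqr realB // normr_real.
Qed.

(* The test vector c u + d u^* is chosen orthogonal to the eigenvector of the
   smallest singular value. *)
Lemma sv2_lower (R U W : 'M[C]_3) (s : 'rV[C]_3) (u : 'cV[C]_3) (w := R^T *m u) :
  map_mx Num.conj R = R ->
  (forall i, 0 <= s 0 i) -> adj U *m U = 1%:M -> adj W *m W = 1%:M ->
  R = U *m diag_mx s *m W -> s 0 1 <= s 0 0 ->
  sqnorm u = 2 -> sqsum u = 0 ->
  2 * s 0 1 ^+ 2 <= sqnorm w + `|sqsum w|.
Proof.
move=> Rr s0 UU WW RE s10 u2 uu.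
have adjR : adj R = R^T by rewrite /adj Rr.
pose y := adj U *m u; pose y' := adj U *m map_mx Num.conj u.
have [c [d [cd cd0]]] : exists c d : C, c * y ord_max 0 + d * y' ord_max 0 = 0
    /\ 0 < c^* * c + d^* * d.
  have pos (c d : C) : (c != 0) || (d != 0) -> 0 < c^* * c + d^* * d.
    rewrite ![_^* * _]mulrC -!normCK lt_def addr_ge0 ?exprn_ge0 // andbT.
    by rewrite paddr_eq0 ?exprn_ge0 // !sqrf_eq0 !normr_eq0 negb_and.
  (* If both last coordinates vanish, any nonzero pair works; otherwise they are swapped with one
     sign changed. *)
  have [z|nz] := boolP ((y' ord_max 0 == 0) && (y ord_max 0 == 0)).
    exists 1, 0; move: z => /andP[_ /eqP ->]; rewrite mulr0 mul0r addr0.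
    by split=> //; apply: pos; rewrite oner_eq0.
  exists (y' ord_max 0), (- y ord_max 0); split; first by rewrite mulrC mulNr subrr.
  by apply: pos; rewrite oppr_eq0 -negb_and.
set K := _ + _ in cd0.
pose v := c *: u + d *: map_mx Num.conj u.
have vn : sqnorm v = K * 2.
  by rewrite sqnorm_conj_comb u2 uu conjC0 mulr0 conjC0 !addr0.
(* The cross term is at most 2|c||d||w.w|, hence at most (|c|^2 + |d|^2)|w.w|. *)
have wn : sqnorm (adj R *m v) <= K * (sqnorm w + `|sqsum w|).
  have -> : adj R *m v = c *: w + d *: map_mx Num.conj w.
    by rewrite adjR mulmxDr -!scalemxAr map_mxM -map_trmx Rr.
  rewrite sqnorm_conj_comb mulrDr lerD2l; apply: le_trans (addC_conj_le _) _.
  rewrite !normrM !norm_conjC mulrA ler_wpM2r ?normr_ge0 //.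
  by rewrite /K ![_^* * _]mulrC -!normCK mul_norm_le.
(* The last coordinate of [adj U *m v] is 0, and the other two carry weights at least s_2^2. *)
have sn : sqnorm (adj R *m v) >= s 0 1 ^+ 2 * sqnorm v.
  rewrite (sqnorm_svd _ s0 WW RE) -(sqnorm_unitary _ (mulmx1C UU)) /sqnorm mulr_sumr.
  rewrite !sum_ord3.
  have z2 : (adj U *m v) ord_max 0 = 0.
    by rewrite mulmxDr -!scalemxAr !mxE; move: cd; rewrite /y /y' !mxE.
  rewrite z2 normr0 expr0n !mulr0 !addr0 ![_^* * _]mulrC -!normCK lerD2r.
  by rewrite ler_wpM2r ?exprn_ge0 // lerXn2r ?nnegrE.
have := le_trans sn wn; rewrite vn mulrCA ler_pM2l //.
by rewrite mulrC.
Qed.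

(** [n] is a real eigenvector of R R^T for s_1^2. If u is orthogonal to [n], so is the whole
    complexified plane, where R R^T is bounded by s_2^2; a suitable v in it turns this into the
    bound on w. *)
Lemma sv2_attained (R U W : 'M[C]_3) (s : 'rV[C]_3) :
  map_mx Num.conj R = R ->
  (forall i, 0 <= s 0 i) -> adj U *m U = 1%:M -> adj W *m W = 1%:M ->
  R = U *m diag_mx s *m W -> s 0 1 <= s 0 0 -> s 0 ord_max <= s 0 1 ->
  exists n : 'cV[C]_3, [/\ n != 0, map_mx Num.conj n = n &
    forall (u : 'cV[C]_3) (w := R^T *m u), n^T *m u = 0 ->
    sqnorm u = 2 -> sqsum u = 0 -> sqnorm w + `|sqsum w| <= 2 * s 0 1 ^+ 2].
Proof.
move=> Rr s0 UU WW RE s10 s21.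
have adjR : adj R = R^T by rewrite /adj Rr.
have UU' := mulmx1C UU.
pose H := R *m adj R.
have HE : adj U *m H = diag_mx s *m diag_mx s *m adj U.
  rewrite /H RE !adjmxM adj_diag // !mulmxA UU mul1mx -!mulmxA [W *m (_ *m _)]mulmxA.
  by rewrite (mulmx1C WW) mul1mx.
have Hr : map_mx Num.conj H = H by rewrite /H adjR map_mxM -map_trmx Rr.
clearbody H.
pose e := col 0 U.
have He : H *m e = s 0 0 ^+ 2 *: e.
  have HU : H *m U = U *m (diag_mx s *m diag_mx s).
    by rewrite -[H]mul1mx -UU' -!mulmxA [adj U *m _]mulmxA HE -!mulmxA UU mulmx1.
  rewrite /e !colE mulmxA HU mulmxA !mul_mx_diag -colE; apply/matrixP=> i j.
  by rewrite -colE !mxE; ring.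
have s0r : (s 0 0 ^+ 2)^* = s 0 0 ^+ 2 by rewrite conj_Creal // rpredX // ger0_real.
have Hec : H *m map_mx Num.conj e = s 0 0 ^+ 2 *: map_mx Num.conj e.
  by rewrite -{1}Hr -map_mxM He map_mxZ /= s0r.
have e0 : e != 0.
  apply/eqP => ez; have /matrixP/(_ 0 0) := UU; rewrite mxE big1 ?mxE.
    by move/eqP; rewrite eq_sym oner_eq0.
  move=> i _; have /matrixP/(_ i 0) := ez; rewrite ![in X in X -> _]mxE => ->.
  by rewrite mulr0.
(* [H] is real, so the conjugate of [e] is an eigenvector too. Their sum is real; if it is 0, [e] is
   purely imaginary and ['i *: e] is real. *)
have [n [n0 nr Hn]] : exists n : 'cV[C]_3,
    [/\ n != 0, map_mx Num.conj n = n & H *m n = s 0 0 ^+ 2 *: n].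
  have conjcK : map_mx Num.conj (map_mx Num.conj e) = e.
    by apply/matrixP=> i j; rewrite !mxE conjCK.
  have [ez|en] := eqVneq (e + map_mx Num.conj e) 0; last first.
    exists (e + map_mx Num.conj e); split=> //; first by rewrite map_mxD conjcK addrC.
    by rewrite mulmxDr He Hec scalerDr.
  exists ('i *: e); split; first by rewrite scaler_eq0 negb_or neq0Ci.
    have /eqP := ez; rewrite addrC addr_eq0 => /eqP ec.
    by rewrite map_mxZ /= conjCi ec scaleNr scalerN opprK.
  by rewrite -scalemxAr He !scalerA mulrC.
exists n; split=> // u w nu u2 uu.
(* The phase [c] makes the cross term exactly |w.w|; if w.w = 0, any phase does. *)
have [c [c1 cB]] : exists c : C, c^* * c = 1 /\ c^* * (sqsum w)^* = `|sqsum w|.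
  have [->|B0] := eqVneq (sqsum w) 0.
    by exists 1; rewrite conjC1 conjC0 normr0 !mulr0 mulr1.
  have nB : `|sqsum w| != 0 by rewrite normr_eq0.
  exists ((sqsum w)^* / `|sqsum w|).
  have -> : ((sqsum w)^* / `|sqsum w|)^* = sqsum w / `|sqsum w|.
    by rewrite rmorphM /= fmorphV /= conjCK (conj_Creal (normr_real _)).
  by split; [rewrite mulf_div -normCK expr2 divff // mulf_neq0 |
     rewrite mulrAC -normCK expr2 mulfK].
pose v := c *: u + 1 *: map_mx Num.conj u.
have vn : sqnorm v = 4.
  rewrite sqnorm_conj_comb u2 uu conjC0 mulr0 conjC0 !addr0 c1 conjC1 mulr1.
  by ring.
have wn : sqnorm (adj R *m v) = 2 * (sqnorm w + `|sqsum w|).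
  have -> : adj R *m v = c *: w + 1 *: map_mx Num.conj w.
    by rewrite adjR mulmxDr -!scalemxAr map_mxM -map_trmx Rr.
  rewrite sqnorm_conj_comb c1 conjC1 !mulr1 cB (conj_Creal (normr_real _)).
  by ring.
suff : sqnorm (adj R *m v) <= s 0 1 ^+ 2 * sqnorm v.
  rewrite wn vn.
  have -> : s 0 1 ^+ 2 * 4 = 2 * (2 * s 0 1 ^+ 2) by ring.
  by rewrite ler_pM2l ?ltr0n.
rewrite (sqnorm_svd _ s0 WW RE) -(sqnorm_unitary _ UU') /sqnorm mulr_sumr !sum_ord3.
rewrite ![_^* * _]mulrC -!normCK.
have sq_le (x y : C) : 0 <= x -> x <= y -> x ^+ 2 <= y ^+ 2.
  by move=> x0 xy; rewrite lerXn2r ?nnegrE // (le_trans x0).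
rewrite lerD //; last by rewrite ler_wpM2r ?exprn_ge0 // sq_le.
rewrite lerD2r.
(* If s_1 = s_2 the first term is bounded trivially. Otherwise s_1^2 is a simple eigenvalue, so
   [adj U *m n] has only its first coordinate nonzero, and orthogonality of v to [n] kills that of
   [adj U *m v]. *)
have [->//|ne] := eqVneq (s 0 0) (s 0 1).
suff -> : (adj U *m v) 0 0 = 0 by rewrite normr0 expr0n !mulr0.
have lt10 : s 0 1 < s 0 0 by rewrite lt_def ne.
pose z := adj U *m n.
have zE i : s 0 i ^+ 2 * z i 0 = s 0 0 ^+ 2 * z i 0.
  have : diag_mx s *m diag_mx s *m z = s 0 0 ^+ 2 *: z.
    by rewrite /z mulmxA -HE -mulmxA Hn scalemxAr.
  move/matrixP/(_ i 0); rewrite [RHS]mxE => <-.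
  by rewrite -[in RHS]mulmxA mul_diag_mx [RHS]mxE mul_diag_mx [in RHS]mxE expr2 mulrA.
have z0 i : s 0 i < s 0 0 -> z i 0 = 0.
  move=> lti; apply/eqP; have /eqP := zE i; rewrite -subr_eq0 -mulrBl mulf_eq0.
  by case/orP=> //; rewrite subr_eq0 eqrXn2 // (lt_eqF lti).
have z1 := z0 1 lt10; have z2 := z0 ord_max (le_lt_trans s21 lt10).
have nv : adj n *m v = 0.
  have -> : adj n = n^T by rewrite /adj nr.
  rewrite mulmxDr -!scalemxAr nu.
  have -> : n^T *m map_mx Num.conj u = 0.
    by rewrite -nr map_trmx -map_mxM nu map_mx0.
  by rewrite !scaler0 addr0.
have : adj z *m (adj U *m v) = 0.
  by rewrite /z adjmxM adjmxK -mulmxA [U *m _]mulmxA UU' mul1mx.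
move/matrixP/(_ 0 0); rewrite mxE sum_ord3 [RHS]mxE ![adj z _ _]mxE.
rewrite ![map_mx _ z _ _]mxE z1 z2 conjC0 !mul0r !addr0 => /eqP.
rewrite mulf_eq0 conjC_eq0 => /orP[/eqP z00|/eqP //].
case/eqP: n0; rewrite -[n]mul1mx -UU' -mulmxA -/z.
suff -> : z = 0 by rewrite mulmx0.
apply/matrixP=> i j; rewrite (ord1 j) [RHS]mxE.
by case: i => [[|[|[|//]]] hi]; [rewrite -z00 | rewrite -z1 | rewrite -z2]; congr (z _ _); apply: val_inj.
Qed.
End MinMax.

(* The eigenvectors of n.sigma, for the eigenvalues r and -r with r^2 = n.n;
   the sign of r is chosen so that the formula below does not degenerate. *)
Lemma basis_of_axis (C : numClosedFieldType) (n : 'cV[C]_3) :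
  n != 0 -> map_mx Num.conj n = n ->
  exists a : 'I_2 -> 'cV[C]_2, orthonormal_basis a /\ n^T *m bloch a = 0.
Proof.
move=> n0 nr.
pose x := n 0 0; pose y := n 1 0; pose z := n ord_max 0.
have real i : n i 0 \is Num.real.
  by apply/CrealP; have /matrixP/(_ i 0) := nr; rewrite mxE.
have [xr yr zr] : [/\ x \is Num.real, y \is Num.real & z \is Num.real] by split; exact: real.
have sq0 (t : C) : t \is Num.real -> 0 <= t ^+ 2 by rewrite realEsqr.
have nn : x ^+ 2 + y ^+ 2 + z ^+ 2 != 0.
  apply: contraNneq n0 => /eqP.
  rewrite !paddr_eq0 ?addr_ge0 ?sq0 // !sqrf_eq0 => /andP[/andP[/eqP x0 /eqP y0] /eqP z0].
  apply/eqP/matrixP=> i j; rewrite (ord1 j) [RHS]mxE.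
  by case: i => [[|[|[|//]]] hi]; [rewrite -x0 | rewrite -y0 | rewrite -z0];
    congr (n _ _); apply: val_inj.
have [r [rr r2 rz]] : exists r : C, [/\ r \is Num.real,
    r ^+ 2 = x ^+ 2 + y ^+ 2 + z ^+ 2 & r + z != 0].
  pose r := sqrtC (x ^+ 2 + y ^+ 2 + z ^+ 2).
  have rr : r \is Num.real by rewrite ger0_real // sqrtC_ge0 !addr_ge0 ?sq0.
  have r2 : r ^+ 2 = x ^+ 2 + y ^+ 2 + z ^+ 2 by rewrite sqrtCK.
  have [rz|rz] := eqVneq (r + z) 0; last by exists r.
  exists (- r); split; rewrite ?realN ?sqrrN //.
  have -> : z = - r by apply/eqP; rewrite -addr_eq0 addrC rz.
  rewrite -opprD oppr_eq0 -mulr2n mulrn_eq0 /= -sqrf_eq0 r2.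
  exact: nn.
pose h := r + z; pose p := x + 'i * y; pose q := x - 'i * y.
have hr : h^* = h by rewrite conj_Creal // realD.
have pq : p^* = q.
  by rewrite rmorphD rmorphM /= conjCi (conj_Creal xr) (conj_Creal yr) mulNr.
have qp : q^* = p by rewrite -pq conjCK.
pose c := sqrtC (h ^+ 2 + (x ^+ 2 + y ^+ 2)).
have c20 : 0 < h ^+ 2 + (x ^+ 2 + y ^+ 2).
  rewrite ltr_pwDl ?addr_ge0 ?sq0 // lt_def sqrf_eq0 rz sq0 //.
  exact: realD.
have c2 : c ^+ 2 = h ^+ 2 + (x ^+ 2 + y ^+ 2) by rewrite sqrtCK.
have c0 : c != 0 by rewrite -sqrf_eq0 c2 gt_eqF.
have cr : c^* = c by rewrite conj_Creal // ger0_real // sqrtC_ge0 ltW.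
have i2 := sqrCi C.
have pqE : p * q = x ^+ 2 + y ^+ 2 by rewrite /p /q; ring: i2.
(* n.sigma has rows (z, q) and (p, -z), so (h, p) and (-q, h) are eigenvectors for r and -r; [c] is
   their common norm. *)
pose a (k : 'I_2) : 'cV[C]_2 := \col_(j < 2)
  (if k == 0 then if j == 0 then h / c else p / c
   else if j == 0 then - q / c else h / c).
have a00 : a 0 0 0 = h / c by rewrite mxE.
have a01 : a 0 1 0 = p / c by rewrite mxE.
have a10 : a 1 0 0 = - q / c by rewrite mxE.
have a11 : a 1 1 0 = h / c by rewrite mxE.
have conjV t : (t / c)^* = t^* / c by rewrite rmorphM /= fmorphV /= cr.
exists a; split.
  apply/orthonormal_basis2; rewrite a00 a01 a10 a11 !conjV rmorphN /= hr pq qp.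
  have cc : c^-1 ^+ 2 * (h ^+ 2 + p * q) = 1 by rewrite pqE -c2 -exprMn mulVf ?expr1n.
  split; first by rewrite -[RHS]cc; ring.
    by rewrite -[RHS]cc; ring.
  by ring.
apply/matrixP=> i j; rewrite (ord1 i) (ord1 j) !mxE sum_ord3.
have [-> -> ->] := blochE a; rewrite ![n^T _ _]mxE -/x -/y -/z.
rewrite a00 a01 a10 a11 !conjV hr pq.
(* n.u = <a_0|n.sigma|a_1> is a multiple of the characteristic equation of r. *)
transitivity (c^-1 ^+ 2 * q * (r ^+ 2 - (x ^+ 2 + y ^+ 2 + z ^+ 2))).
  by rewrite /h /q; ring: i2.
by rewrite r2 subrr mulr0.
Qed.

(* Q^A_N(rho) = min over orthonormal bases a of A of
   N_{AB:A'}((V_a (x) I_B) rho (V_a (x) I_B)^dagger); "min = s2/2" is stated as: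
   s2/2 is attained by some basis and is a lower bound over all bases. *)
Theorem theorem12 (C : numClosedFieldType) (rho : 'M[C]_(2 * 2)) :
  density rho ->
  ptraceB (n := 2) rho = (2%:R)^-1%:M ->
  forall s1 s2 s3 : C,
    singular_values (Rhat rho) (\row_(i < 3) [:: s1; s2; s3]`_i) ->
    s2 <= s1 -> s3 <= s2 -> 0 <= s3 ->
    (exists a : 'I_2 -> 'cV[C]_2, orthonormal_basis a /\
        negativity_ABA' (measured (n := 2) a rho) = s2 / 2%:R) /\
    (forall a : 'I_2 -> 'cV[C]_2, orthonormal_basis a ->
        s2 / 2%:R <= negativity_ABA' (measured (n := 2) a rho)).
Proof.
move=> rho_d rhoA s1 s2 s3; set s := \row_i _ => -[s_ge0 [U [W [UU [WW RE]]]]] s21 s32 s30.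
have [E0 E1 E2] : [/\ s 0 0 = s1, s 0 1 = s2 & s 0 ord_max = s3] by split; rewrite mxE.
have Rr : map_mx Num.conj (Rhat rho) = Rhat rho by apply: Rhat_real; case: rho_d => -[].
have s2_ge0 : 0 <= s2 by exact: le_trans s32.
pose f (u : 'cV[C]_3) := sqnorm ((Rhat rho)^T *m u) + `|sqsum ((Rhat rho)^T *m u)|.
have negE a : orthonormal_basis a ->
    negativity_ABA' (measured (n := 2) a rho) = sqrtC (8^-1 * f (bloch a)).
  by move=> ha; rewrite negativity_qubit // gram_off_block.
(* Comparing radicands, it remains to show that [f] has minimum [2 * s2 ^+ 2]. *)
have s2E : s2 / 2 = sqrtC (8^-1 * (2 * s2 ^+ 2)).
  have -> : 8^-1 * (2 * s2 ^+ 2) = (s2 / 2) ^+ 2 by field.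
  by rewrite sqrCK // divr_ge0.
have lower a : orthonormal_basis a -> 2 * s2 ^+ 2 <= f (bloch a).
  move=> ha; rewrite -E1.
  by apply: sv2_lower UU WW RE _ _ _; rewrite ?E0 ?E1 ?sqnorm_bloch ?sqsum_bloch.
split=> [|a ha].
  (* Measuring along the axis [n] puts u in the plane orthogonal to it, which gives the upper
     bound. *)
  have [||n [n0 nr up]] := sv2_attained Rr s_ge0 UU WW RE; rewrite ?E0 ?E1 ?E2 //.
  have [a [ha na]] := basis_of_axis n0 nr; exists a; split=> //.
  rewrite negE // s2E; congr (sqrtC (_ * _)); apply/eqP; rewrite eq_le lower // andbT -E1.
  by apply: up; rewrite ?sqnorm_bloch ?sqsum_bloch.
have f0 : 0 <= f (bloch a).
  by apply: le_trans (lower a ha); rewrite mulr_ge0 ?exprn_ge0.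
rewrite negE // s2E ler_sqrtC ?qualifE /= ?mulr_ge0 ?invr_ge0 ?exprn_ge0 //.
by rewrite ler_pM2l ?invr_gt0 ?ltr0n // lower.
Qed.
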